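(* Let $x_1,\dots,x_n\in\mathbb{R}^d$, let $\phi$ be a feature map on $\mathbb{R}^d$, and let $K=K(X,X)\in\mathbb{R}^{n\times n}$ be the kernel matrix $K_{ij}=\langle\phi(x_i),\phi(x_j)\rangle$. Let $K=UDU^{T}$ be a singular value decomposition of the (symmetric positive semidefinite) matrix $K$, with $U\in\mathbb{R}^{n\times n}$ orthogonal and $D=\mathrm{diag}(\sigma_1,\dots,\sigma_n)$, where $\sigma_i\ge 0$ are the singular values of $K$. Let $\lambda\ge 0$. Then the kernelized low-rank representation problem $$\min_{Z\in\mathbb{R}^{n\times n}}\ \tfrac12\|\phi(X)-\phi(X)Z\|_F^2+\lambda\|Z\|_*$$ is minimized by $$Z^*=U D_\lambda U^{T},$$ where $D_\lambda$ is the diagonal matrix with entries $$D_\lambda(i,i)=\begin{cases}1-\dfrac{\lambda}{\sigma_i} & \text{if }\sigma_i>\lambda,\\[1ex] 0 & \text{otherwise.}\end{cases}$$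
   Context: $\phi$ maps $\mathbb{R}^d$ into a real inner product (Hilbert) space $H$ (e.g. $\mathbb{R}^D$), the ''expanded basis space''. $X=[x_1,\dots,x_n]$ is the data, and $\phi(X)=[\phi(x_1),\dots,\phi(x_n)]$ is viewed as a matrix whose columns are elements of $H$, so $\phi(X)^T\phi(X)=K(X,X)$. For $Z\in\mathbb{R}^{n\times n}$, the $j$th column of $\phi(X)Z$ is $\sum_i Z_{ij}\phi(x_i)$. $\|\cdot\|_F$ is the Frobenius norm (square root of the sum of squared norms of the columns), and $\|Z\|_*$ is the nuclear norm (sum of the singular values of $Z$). *)

(* Defs.v *)
(* R : realType plays the role of the field of real numbers. *)
From mathcomp Require Import all_boot all_order all_algebra.
From mathcomp Require Import reals.
From mathcomp Require Import polyrcf.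

Set Implicit Arguments.
Unset Strict Implicit.
Unset Printing Implicit Defensive.

Import Order.TTheory GRing.Theory Num.Theory.
Local Open Scope ring_scope.

Section SingularValues.
Variables (R : realType) (m n : nat).

(* The n square roots of the eigenvalues of Z^T Z, each repeated according to
   its multiplicity as a root of the characteristic polynomial: [rootsR] lists
   the distinct real roots and [mup] gives their multiplicities. *)
Definition singular_values (Z : 'M[R]_(m, n)) : seq R :=
  let p := char_poly (Z^T *m Z) in
  flatten [seq nseq (mup a p) (Num.sqrt a) | a <- rootsR p].

Definition nuclear_norm (Z : 'M[R]_(m, n)) : R :=
  \sum_(s <- singular_values Z) s.

End SingularValues.

(* A matrix with n columns in the inner product space H is an element of
   'rV[H]_n, its j-th column being the entry (0, j).  The real inner product is
   a symmetric (sesquilinear for the identity) positive definite form. *)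
Section FeatureSpace.
Variables (R : realType) (H : lmodType R) (ip : {dot H for idfun}) (n : nat).

Definition feature_mulmx (F : 'rV[H]_n) (Z : 'M[R]_n) : 'rV[H]_n :=
  \row_j \sum_i Z i j *: F 0 i.

Definition frobenius_norm (F : 'rV[H]_n) : R :=
  Num.sqrt (\sum_j ip (F 0 j) (F 0 j)).

Variables (d : nat) (phi : 'cV[R]_d -> H) (X : 'M[R]_(d, n)).

(* The data points are the columns of X. *)
Definition feature_mx : 'rV[H]_n := \row_j phi (col j X).

Definition kernel_mx : 'M[R]_n :=
  \matrix_(i, j) ip (phi (col i X)) (phi (col j X)).

Definition lrr_objective (lambda : R) (Z : 'M[R]_n) : R :=
  2^-1 * frobenius_norm (feature_mx - feature_mulmx feature_mx Z) ^+ 2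
  + lambda * nuclear_norm Z.

End FeatureSpace.

Definition shrink (R : realType) (n : nat) (lambda : R) (sigma : 'rV[R]_n) :
    'rV[R]_n :=
  \row_i (if lambda < sigma 0 i then 1 - lambda / sigma 0 i else 0).

(* Main.v *)
(** The nuclear norm and the Frobenius term are unitarily invariant, so with
    [W = U^T Z U] the objective is
    [1/2 sum_ij sigma_i (1 - W)_ij^2 + lambda ||W||_*].  Dropping the
    off-diagonal squares and using [||W||_* >= sum_i |W_ii|] (an equality for
    diagonal [W]) bounds it below by a sum of the scalar problems
    [1/2 sigma_i (1 - w)^2 + lambda |w|], each minimized by the shrunk value.
    For the trace bound, diagonalize [W^T W = V diag(mu) V^H] and write
    [W_ii = sum_k (W V)_ik (V^H)_ki]: the k-th column of [W V] has norm
    [sqrt mu_k] and the k-th row of [V^H] is a unit vector, so Cauchy-Schwarz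
    over [i] and summation over [k] give [sum_k sqrt mu_k = ||W||_*]. *)
Require Import Defs.
From mathcomp Require Import all_boot all_order all_algebra.
From mathcomp Require Import reals polyrcf complex ring.

Set Implicit Arguments.
Unset Strict Implicit.
Unset Printing Implicit Defensive.

Import Order.TTheory GRing.Theory Num.Theory.
Local Open Scope ring_scope.
Local Open Scope sesquilinear_scope.

(** Cauchy-Schwarz for [dotmx], applied to the rows of moduli so that the absolute values stay
    inside the sum. *)
Lemma sum_normM_le (C : numClosedFieldType) (n : nat) (a b : 'I_n -> C) :
  \sum_i `|a i * b i|
  <= sqrtC (\sum_i `|a i| ^+ 2) * sqrtC (\sum_i `|b i| ^+ 2).
Proof.
have dotE (u v : 'I_n -> C) :
    dotmx (\row_i `|u i|) (\row_i `|v i|) = \sum_i `|u i * v i|.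
  rewrite dotmxE mxE; apply: eq_bigr => i _.
  by rewrite !mxE geC0_conj // normrM.
have CS (u v : 'rV[C]_n) :
    `|dotmx u v| <= sqrtC (dotmx u u) * sqrtC (dotmx v v).
  exact: (CauchySchwarz_sqrt (@dotmx C n) u v).1.
have := CS (\row_i `|a i|) (\row_i `|b i|).
have sqE (u : 'I_n -> C) : \sum_i `|u i * u i| = \sum_i `|u i| ^+ 2.
  by apply: eq_bigr => i _; rewrite normrM.
by rewrite !dotE !sqE ger0_norm ?sumr_ge0.
Qed.

(** The trace bound for an arbitrary unitary diagonalization of the Gram matrix of [A].
    Nonnegativity of [D] is returned as well, since it makes the eigenvalues real. *)
Lemma sum_diag_norm_le_spectral (C : numClosedFieldType) (n : nat)
    (A P : 'M[C]_n) (D : 'rV[C]_n) :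
  P \is unitarymx -> A ^t* *m A = P ^t* *m diag_mx D *m P ->
  (forall k, 0 <= D 0 k) /\ \sum_i `|A i i| <= \sum_k sqrtC (D 0 k).
Proof.
move=> Pu AAE; have PP1 := unitarymxP Pu.
have P1P : P ^t* *m P = 1%:M by exact/mulmx1C.
(* The columns of [G] are orthogonal with squared norms [D 0 k]. *)
pose G := A *m P ^t*.
have GG : G ^t* *m G = diag_mx D.
  rewrite /G trmx_mul map_mxM trmxCK mulmxA -(mulmxA P) AAE !mulmxA PP1 mul1mx.
  by rewrite -mulmxA PP1 mulmx1.
have DE k : D 0 k = \sum_i `|G i k| ^+ 2.
  have /matrixP/(_ k k) := GG; rewrite !mxE eqxx mulr1n => <-.
  by apply: eq_bigr => i _; rewrite !mxE normCK mulrC.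
have QE k : \sum_i `|P k i| ^+ 2 = 1.
  have /matrixP/(_ k k) := PP1; rewrite !mxE eqxx mulr1n => <-.
  by apply: eq_bigr => i _; rewrite !mxE normCK.
split=> [k|]; first by rewrite DE sumr_ge0 // => i _; rewrite exprn_ge0.
have -> : A = G *m P by rewrite /G -mulmxA P1P mulmx1.
apply: (@le_trans _ _ (\sum_i \sum_k `|G i k * P k i|)).
  by apply: ler_sum => i _; rewrite mxE ler_norm_sum.
rewrite exchange_big; apply: ler_sum => k _.
apply: le_trans (sum_normM_le _ _) _.
by rewrite QE sqrtC1 mulr1 DE.
Qed.

(** Lets the nuclear norm be read off any listing of the eigenvalues: a root's multiplicity is the
    number of times it is listed. *)
Lemma nuclear_norm_prod (R : realType) (m n : nat) (Z : 'M[R]_(m, n))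
    (mu : 'rV[R]_n) :
  char_poly (Z^T *m Z) = \prod_i ('X - (mu 0 i)%:P) ->
  nuclear_norm Z = \sum_i Num.sqrt (mu 0 i).
Proof.
rewrite /nuclear_norm /singular_values => ->.
pose s := [seq mu 0 i | i <- enum 'I_n].
have -> : \prod_i ('X - (mu 0 i)%:P) = \prod_(y <- s) ('X - y%:P).
  by rewrite big_map big_enum.
set p := \prod_(y <- s) _.
have p_neq0 : p != 0 by apply: monic_neq0; exact: monic_prod_XsubC.
rewrite big_flatten big_map /=.
(* Each constant block becomes an iterated sum of length [count], the shape that
   [big_undup_iterop_count] regroups. *)
under eq_bigr => a _ do
  rewrite big_nseq -[X in iter _ X]/(+%R _) -Monoid.iteropE mu_prod_XsubC.
rewrite (perm_big (undup s)) /=; last first.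
  apply: uniq_perm; rewrite ?undup_uniq ?uniq_roots // => a.
  by rewrite mem_undup -(roots_on_rootsR p_neq0) in_itv /= root_prod_XsubC.
by rewrite big_undup_iterop_count /s big_map big_enum.
Qed.

(** A separate one-sided inverse [W] covers both the transpose of [U] and the conjugate transpose of
    a unitary matrix. *)
Lemma char_poly_conj (R : comUnitRingType) (n : nat) (V W A : 'M[R]_n) :
  V *m W = 1%:M -> char_poly (V *m A *m W) = char_poly A.
Proof.
move=> VW; rewrite /char_poly.
have -> : char_poly_mx (V *m A *m W)
    = map_mx polyC V *m char_poly_mx A *m map_mx polyC W.
  rewrite /char_poly_mx mulmxBr mulmxBl !map_mxM /=; congr (_ - _).
  by rewrite scalar_mxC -mulmxA -map_mxM VW map_mx1 mulmx1.
by rewrite !det_mulmx mulrAC -det_mulmx -map_mxM VW map_mx1 det1 mul1r.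
Qed.

Lemma nuclear_norm_orthogonal_conj (R : realType) (n : nat) (U Z : 'M[R]_n) :
  U^T *m U = 1%:M -> nuclear_norm (U *m Z *m U^T) = nuclear_norm Z.
Proof.
move=> UU; rewrite /nuclear_norm /singular_values.
have -> : (U *m Z *m U^T)^T *m (U *m Z *m U^T) = U *m (Z^T *m Z) *m U^T.
  by rewrite !trmx_mul trmxK !mulmxA -(mulmxA _ U^T) UU mulmx1.
by rewrite char_poly_conj //; exact: mulmx1C.
Qed.

Lemma char_poly_diag (R : comNzRingType) (n : nat) (D : 'rV[R]_n) :
  char_poly (diag_mx D) = \prod_i ('X - (D 0 i)%:P).
Proof.
rewrite char_poly_trig ?diag_mx_is_trig //.
by apply: eq_bigr => i _; rewrite mxE eqxx.
Qed.

Lemma nuclear_norm_diag (R : realType) (n : nat) (D : 'rV[R]_n) :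
  nuclear_norm (diag_mx D) = \sum_i `|D 0 i|.
Proof.
rewrite (@nuclear_norm_prod _ _ _ _ (\row_i D 0 i ^+ 2)).
  by apply: eq_bigr => i _; rewrite mxE sqrtr_sqr.
rewrite tr_diag_mx mulmx_diag char_poly_diag.
by apply: eq_bigr => i _; rewrite !mxE.
Qed.

Local Notation toC := (real_complex _).

(* MathComp's spectral theorem is over an algebraically closed field, hence
   the detour through R[i]. *)
Lemma sum_diag_norm_le_nuclear_norm (R : realType) (n : nat) (Z : 'M[R]_n) :
  \sum_i `|Z i i| <= nuclear_norm Z.
Proof.
have conj_toC (x : R) : (toC x)^* = toC x by exact: conjc_real.
pose A := map_mx toC Z.
have AtE : A ^t* = map_mx toC Z^T.
  by apply/matrixP => i j; rewrite !mxE; exact: conj_toC.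
pose B := A ^t* *m A.
have BE : B = map_mx toC (Z^T *m Z) by rewrite /B AtE map_mxM.
have Bn : B \is normalmx.
  by apply/normalmxP; rewrite {2 3}/B trmx_mul map_mxM /= trmxCK.
pose P := spectralmx B; pose D := spectral_diag B.
have Pu : P \is unitarymx by exact: spectral_unitarymx.
have BD : B = P ^t* *m diag_mx D *m P.
  by rewrite -invmx_unitary //; exact/orthomx_spectralP.
have [D_ge0 leD] := sum_diag_norm_le_spectral Pu BD.
(* The entries of [D] are nonnegative, hence real, so taking real parts loses nothing. *)
pose mu := \row_k complex.Re (D 0 k).
have DE k : D 0 k = toC (mu 0 k) by rewrite mxE RRe_real // ger0_real.
rewrite (@nuclear_norm_prod _ _ _ _ mu).
  rewrite -lecR !rmorph_sum /=.
  have mu_ge0 k : 0 <= mu 0 k by rewrite -lecR; have := D_ge0 k; rewrite DE.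
  have sqrtE k : sqrtC (D 0 k) = toC (Num.sqrt (mu 0 k)).
    rewrite DE -[in LHS](sqr_sqrtr (mu_ge0 k)) rmorphXn /= sqrCK //.
    by rewrite lecR sqrtr_ge0.
  under [leRHS]eq_bigr do rewrite -sqrtE.
  apply: le_trans leD; apply: ler_sum => i _.
  by rewrite mxE normc_def /= expr0n addr0 sqrtr_sqr.
(* The real factorization is checked in R[i], where [B] is unitarily similar to [diag_mx D]. *)
apply: (map_poly_inj toC).
rewrite map_char_poly -BE BD char_poly_conj; last first.
  by apply/mulmx1C/unitarymxP.
rewrite char_poly_diag rmorph_prod /=; apply: eq_bigr => k _.
by rewrite rmorphB /= map_polyX map_polyC DE.
Qed.

(** Eliminates the feature space: only its Gram matrix survives. *)
Lemma sqr_frobenius_norm_mulmx (R : realType) (H : lmodType R)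
    (ip : {dot H for idfun}) (n : nat) (F : 'rV[H]_n) (M : 'M[R]_n) :
  frobenius_norm ip (feature_mulmx F M) ^+ 2
  = \tr (M^T *m (\matrix_(i, j) ip (F 0 i) (F 0 j)) *m M).
Proof.
have ip_ge0 (u : H) : 0 <= ip u u.
  have [->|u_neq0] := eqVneq u 0; first by rewrite linear0r.
  by rewrite ltW ?neq0_dnorm_gt0.
rewrite /frobenius_norm sqr_sqrtr ?sumr_ge0 // /mxtrace.
apply: eq_bigr => j _; rewrite !mxE linear_sumr; apply: eq_bigr => k _.
rewrite linearZr /= linear_sumlz mxE mulrC; congr (_ * _).
by apply: eq_bigr => i _; rewrite linearZl_LR !mxE.
Qed.

Lemma sub_feature_mulmx (R : realType) (H : lmodType R) (n : nat)
    (F : 'rV[H]_n) (Z : 'M[R]_n) :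
  F - feature_mulmx F Z = feature_mulmx F (1%:M - Z).
Proof.
apply/rowP => j; rewrite !mxE.
under [RHS]eq_bigr do rewrite !mxE scalerBl.
rewrite sumrB; congr (_ - _); rewrite (bigD1 j) //= eqxx scale1r.
rewrite big1 ?addr0 // => i /negPf ->.
by rewrite scale0r.
Qed.

Lemma lrr_objective_orthogonal_conj (R : realType) (d n : nat) (H : lmodType R)
    (ip : {dot H for idfun}) (phi : 'cV[R]_d -> H) (X : 'M[R]_(d, n))
    (U W : 'M[R]_n) (sigma : 'rV[R]_n) (lambda : R) :
  U^T *m U = 1%:M ->
  kernel_mx ip phi X = U *m diag_mx sigma *m U^T ->
  lrr_objective ip phi X lambda (U *m W *m U^T)
  = 2^-1 * \sum_j \sum_i sigma 0 i * (1%:M - W) i j ^+ 2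
    + lambda * nuclear_norm W.
Proof.
move=> UU KE; have UU1 := mulmx1C UU.
rewrite /lrr_objective nuclear_norm_orthogonal_conj //.
congr (_ * _ + _).
set F := feature_mx phi X; set Z := U *m W *m U^T.
rewrite sub_feature_mulmx sqr_frobenius_norm_mulmx.
have -> : \matrix_(i, j) ip (F 0 i) (F 0 j) = kernel_mx ip phi X.
  by apply/matrixP => i j; rewrite !mxE.
have -> : 1%:M - Z = U *m (1%:M - W) *m U^T.
  by rewrite mulmxBr mulmxBl mulmx1 UU1.
rewrite KE !trmx_mul trmxK.
have -> : U *m ((1%:M - W)^T *m U^T) *m (U *m diag_mx sigma *m U^T)
    *m (U *m (1%:M - W) *m U^T)
  = U *m ((1%:M - W)^T *m diag_mx sigma *m (1%:M - W) *m U^T).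
  by rewrite !mulmxA -!(mulmxA _ U^T U) UU !mulmx1.
(* Cyclicity of the trace cancels the outer [U] against [U^T]. *)
rewrite mxtrace_mulC -(mulmxA _ U^T) UU mulmx1 /mxtrace; apply: eq_bigr => j _.
rewrite mxE; apply: eq_bigr => i _.
by rewrite mul_mx_diag !mxE; ring.
Qed.

Lemma shrink_min (R : realType) (s lambda w : R)
    (t := if lambda < s then 1 - lambda / s else 0) :
  0 <= s -> 0 <= lambda ->
  2^-1 * (s * (1 - t) ^+ 2) + lambda * `|t|
  <= 2^-1 * (s * (1 - w) ^+ 2) + lambda * `|w|.
Proof.
move=> s_ge0 l_ge0; rewrite /t; case: ltP => [ls|sl].
  have s_gt0 : 0 < s by exact: le_lt_trans ls.
  have t_ge0 : 0 <= 1 - lambda / s by rewrite subr_ge0 ler_pdivrMr // mul1r ltW.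
  rewrite (ger0_norm t_ge0).
  (* Replacing [|w|] by [w] costs nothing at the minimizer, which is nonnegative; what remains is a
     quadratic, and completing the square centres it at [1 - lambda / s]. *)
  have le1 : lambda * w <= lambda * `|w| by rewrite ler_wpM2l ?ler_norm.
  apply: le_trans (lerD (lexx _) le1); rewrite -subr_ge0.
  have -> : 2^-1 * (s * (1 - w) ^+ 2) + lambda * w -
    (2^-1 * (s * (1 - (1 - lambda / s)) ^+ 2) + lambda * (1 - lambda / s))
    = 2^-1 * (s * (1 - lambda / s - w) ^+ 2) by field; rewrite gt_eqF.
  by rewrite mulr_ge0 ?invr_ge0 // mulr_ge0 ?sqr_ge0.
(* As [s <= lambda], the penalty absorbs the linear term [- s * w] of the expanded square, leaving
   an excess of [s * w ^+ 2 / 2] over the value at 0. This includes [s = 0]. *)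
have le1 : s * w <= lambda * `|w|.
  by apply: (le_trans (ler_wpM2l s_ge0 (ler_norm w))); rewrite ler_wpM2r.
rewrite normr0 mulr0 addr0 subr0.
apply: le_trans (lerD (lexx _) le1); rewrite -subr_ge0.
have -> : 2^-1 * (s * (1 - w) ^+ 2) + s * w - 2^-1 * (s * 1 ^+ 2)
  = 2^-1 * (s * w ^+ 2) by field.
by rewrite mulr_ge0 ?invr_ge0 // mulr_ge0 ?sqr_ge0.
Qed.

Theorem theorem1 (R : realType) (d n : nat) (H : lmodType R)
    (ip : {dot H for idfun}) (phi : 'cV[R]_d -> H) (X : 'M[R]_(d, n))
    (U : 'M[R]_n) (sigma : 'rV[R]_n) (lambda : R)
    (U_orthogonal : U^T *m U = 1%:M)
    (sigma_ge0 : forall i : 'I_n, 0 <= sigma 0 i)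
    (svd_K : kernel_mx ip phi X = U *m diag_mx sigma *m U^T)
    (lambda_ge0 : 0 <= lambda) :
  forall Z : 'M[R]_n,
    lrr_objective ip phi X lambda (U *m diag_mx (shrink lambda sigma) *m U^T)
    <= lrr_objective ip phi X lambda Z.
Proof.
move=> Z; pose W := U^T *m Z *m U.
have UU1 := mulmx1C U_orthogonal.
have -> : Z = U *m W *m U^T.
  by rewrite /W !mulmxA UU1 mul1mx -mulmxA UU1 mulmx1.
rewrite !(lrr_objective_orthogonal_conj _ _ U_orthogonal svd_K).
rewrite nuclear_norm_diag.
set D := shrink lambda sigma.
(* The intermediate value is the sum of the scalar objectives at the diagonal of [W]: the first
   inequality is [shrink_min] termwise, the second restores the off-diagonal squares and the full
   nuclear norm. *)
apply: (@le_trans _ _ (\sum_j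
    (2^-1 * (sigma 0 j * (1 - W j j) ^+ 2) + lambda * `|W j j|))).
  rewrite !mulr_sumr -big_split /=; apply: ler_sum => j _.
  rewrite (bigD1 j) //= big1 ?addr0 => [|i /negPf ij]; last first.
    by rewrite !mxE ij subr0 expr0n mulr0.
  by rewrite !mxE eqxx !mulr1n; exact: shrink_min.
rewrite big_split /= -!mulr_sumr; apply: lerD; last first.
  by rewrite ler_wpM2l ?sum_diag_norm_le_nuclear_norm.
rewrite ler_wpM2l ?invr_ge0 //; apply: ler_sum => j _.
rewrite (bigD1 j) //= !mxE eqxx lerDl sumr_ge0 // => i _.
by rewrite mulr_ge0 ?sqr_ge0.
Qed.
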